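(* Let $\overline{\mathcal{F}}$ (resp. $\overline{\mathcal{L}}$) be the set of overpartitions in which the first (resp. last) occurrence of a number may be overlined and no two adjacent parts are both overlined. For $r\geq 1$, let $\mathcal{F}_r$ (resp. $\mathcal{L}_r$) be the set of overpartitions in which the first (resp. last) occurrence of a number may be overlined and there are no $r$ consecutive parts which are all non-overlined. Then \[\sum_{\pi\in\overline{\mathcal{F}}}z^{\ell_o(\pi)}q^{|\pi|}=1+\sum_{m\geq 1}\sum_{s\geq 0}\frac{z^sq^{m+s^2-s}}{(q;q)_m}{{m-s+1}\brack{s}}_1,\] \[\sum_{\pi\in\overline{\mathcal{L}}}z^{\ell_o(\pi)}q^{|\pi|}=1+\sum_{m\geq 1}\sum_{s\geq 0}\frac{z^sq^{m+(s-1)^2}}{(q;q)_m}\left({{m-s}\brack{s-1}}_1+q^{2s-1}{{m-s}\brack{s}}_1\right),\] \[\sum_{\pi\in\mathcal{F}_r}z^{\ell_o(\pi)}q^{|\pi|}=1+\sum_{m\geq 1}\sum_{s\geq 0}\frac{z^sq^{m+(s^2-s)/2}}{(q;q)_m}\sum_{i\geq 0}(-1)^iq^{r(i^2-i)/2}{{s+1}\brack {i}}_{r}{{m-ri}\brack {s}}_{1},\] and \begin{align*} &\sum_{\pi\in\mathcal{L}_r}z^{\ell_o(\pi)}q^{|\pi|}=1+\sum_{m\geq 1}\frac{1}{(q;q)_m}\Bigg\{q^m{{r-m-1}\brack {0}}_{1}+\sum_{s\geq 1}z^sq^{m+(s^2-s)/2}\Bigg(\sum_{i\geq 0}(-1)^iq^{r(i^2-i)/2}{{s}\brack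 {i}}_{r}{{m-ri-1}\brack {s-1}}_{1}\\ &\qquad\qquad+q^m\sum_{j=1}^{r-1}\sum_{i\geq 0}(-1)^iq^{r(i^2-i)/2-j}{{s}\brack {i}}_{r}{{m-j-ri-1}\brack {s-1}}_{1}\Bigg)\Bigg\}. \end{align*}
   Context: An overpartition is a partition (finite non-increasing sequence of positive integers, possibly empty) in which the first occurrence (in the ''first'' convention) or the last occurrence (in the ''last'' convention) of a number may be overlined. Parts are listed in non-increasing order of size; in the ''first'' convention an overlined copy $\overline{t}$ is listed before the non-overlined copies of $t$, in the ''last'' convention after them. ''Adjacent''/''consecutive'' parts refer to positions in this list. For a part $\pi_i$, $|\pi_i|=t$ if $\pi_i=t$ or $\overline{t}$; $|\pi|$ is the sum of the $|\pi_i|$; $\ell_o(\pi)$ is the number of overlined parts. $|q|<1$. $(x;q)_0=1$, $(x;q)_n=(1-x)(1-xq)\cdots(1-xq^{n-1})$. For a positive integer $k$ and integers $A,B$, ${A\brack B}_k=\frac{(q^k;q^k)_A}{(q^k;q^k)_B(q^k;q^k)_{A-B}}$ if $A\geq B\geq 0$, and $0$ otherwise. *)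

(* Defs.v *)
From HB Require Import structures.
From mathcomp Require Import all_boot all_order all_algebra.
From mathcomp Require Import complex.
From mathcomp Require Import all_classical all_reals all_analysis.
From mathcomp.analysis.showcase Require summability.

Set Implicit Arguments.
Unset Strict Implicit.
Unset Printing Implicit Defensive.
Import Order.TTheory GRing.Theory Num.Theory.
Import numFieldNormedType.Exports.

Local Open Scope classical_set_scope.
Local Open Scope ring_scope.

(* A part is a pair (size, is it overlined?); a list of parts is the list as
   written, so "adjacent" and "consecutive" refer to positions in the list. *)
Definition part := (nat * bool)%type.

Definition sizes (pi : seq part) : seq nat := unzip1 pi.
Definition overlines (pi : seq part) : seq bool := unzip2 pi.

Definition is_partition (s : seq nat) : bool :=
  sorted geq s && all (fun t => 0 < t)%N s.

Definition overpartition_first (pi : seq part) : bool :=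
  is_partition (sizes pi) &&
  [forall i : 'I_(size pi), nth false (overlines pi) i ==>
     (nth 0%N (sizes pi) i \notin take i (sizes pi))].

Definition overpartition_last (pi : seq part) : bool :=
  is_partition (sizes pi) &&
  [forall i : 'I_(size pi), nth false (overlines pi) i ==>
     (nth 0%N (sizes pi) i \notin drop i.+1 (sizes pi))].

Definition no_adjacent_overlined (pi : seq part) : bool :=
  ~~ infix [:: true; true] (overlines pi).

Definition no_consecutive_nonoverlined (r : nat) (pi : seq part) : bool :=
  ~~ infix (nseq r false) (overlines pi).

Definition Fbar (pi : seq part) : bool :=
  overpartition_first pi && no_adjacent_overlined pi.
Definition Lbar (pi : seq part) : bool :=
  overpartition_last pi && no_adjacent_overlined pi.
Definition Fr (r : nat) (pi : seq part) : bool :=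
  overpartition_first pi && no_consecutive_nonoverlined r pi.
Definition Lr (r : nat) (pi : seq part) : bool :=
  overpartition_last pi && no_consecutive_nonoverlined r pi.

Definition weight (pi : seq part) : nat := sumn (sizes pi).
Definition num_overlined (pi : seq part) : nat := count id (overlines pi).

Section Complex.
Variable R : realType.

(* [R[i]^o] is [R[i]] with the topology of its absolute value. *)

(* The generating function of P converges to S: unordered sum, i.e. the limit
   of the partial sums over the directed set of finite subsets of P. *)
Definition has_gf (P : pred (seq part)) (z q : R[i]) (S : R[i]^o) : Prop :=
  summability.partial_sum
    (fun p : {p : seq part | P p} =>
       z ^+ num_overlined (val p) * q ^+ weight (val p) : R[i]^o)
    @ summability.totally --> S.

Definition qpoch (x q : R[i]) (n : nat) : R[i] := \prod_(i < n) (1 - x * q ^+ i).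

Definition qbinom (q : R[i]) (k : nat) (A B : int) : R[i] :=
  if (0 <= B) && (B <= A) then
    qpoch (q ^+ k) (q ^+ k) `|A|%N /
      (qpoch (q ^+ k) (q ^+ k) `|B|%N * qpoch (q ^+ k) (q ^+ k) `|A - B|%N)
  else 0.

(* Value of the series \sum_(i >= m) u i (arbitrary if it diverges).  It is
   only used for the sums over s and i, where [qbinom] leaves finitely many
   nonzero terms. *)
Definition csum (m : nat) (u : nat -> R[i]) : R[i] :=
  limn (fun n => \sum_(m <= i < n) u i : R[i]^o).

End Complex.

Notation "\sum_ ( m <= i <oo ) F" := (csum m (fun i : nat => F)) : ring_scope.

(* Main.v *)
(* Fix the number m of parts and the pattern b of overlines.  The differences of
   consecutive parts are then independent nonnegative integers, up to a forced
   drop of 1 just before (resp. after) each overlined part, so the overpartitions with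
   pattern b contribute q^(m + stat b) / (q;q)_m, where stat b is the sum of the
   0-based positions of the overlines in the "first" convention and of the 1-based
   positions other than m in the "last" one.  It remains to sum z^|b| q^(stat b)
   over the admissible binary words b of length m:
   - if "11" is forbidden, removing the first letter (or "10") gives the q-Pascal
     rule;
   - if 0^r is forbidden, splitting off the leading run of zeros gives a recursion
     in the number s of ones, whose solution is the coefficient extraction from
     prod_(k <= s) (1 - (x q^k)^r) / (1 - x q^k);
   - in the "last" convention one splits off the last letter, respectively the
     trailing run of zeros, and falls back on the previous sums.
   The sum over all overpartitions converges absolutely because the sum over m of
   the absolute values passes the ratio test, the ratio tending to |q|. *)
Require Import Defs.
From mathcomp Require Import all_boot all_order all_algebra finmap.
From mathcomp Require Import complex.
From mathcomp Require Import all_classical all_reals all_analysis.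
From mathcomp.analysis.showcase Require summability.
From mathcomp Require Import zify ring lra.

Set Implicit Arguments.
Unset Strict Implicit.
Unset Printing Implicit Defensive.
Import Order.TTheory GRing.Theory Num.Theory.
Import numFieldNormedType.Exports.

(** * Overpartitions as sequences of increments *)

(* A gap function gives, from the overlines of a part and of all later parts, the
   least admissible difference between this part and the next one; past the end,
   the next part counts as 1, so that the last part has no forced gap. *)
Definition gap_first (b : seq bool) : nat := nth false b 1.

Definition gap_last (b : seq bool) : nat := if b is x :: _ :: _ then x else false.

(** A code stores for each part its excess over the least size that the next part and the gap allow.
    The excesses are unconstrained, so every list of pairs is a code. *)
Fixpoint decode_gaps (g : seq bool -> nat) (e : seq (nat * bool)) : seq part :=
  if e is (d, x) :: e' then
    (d + (g (x :: overlines e') + head 1 (sizes (decode_gaps g e'))), x) :: decode_gaps g e'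
  else [::].

Fixpoint encode_gaps (g : seq bool -> nat) (pi : seq part) : seq (nat * bool) :=
  if pi is (a, x) :: pi' then
    (a - (g (x :: overlines pi') + head 1 (sizes pi')), x) :: encode_gaps g pi'
  else [::].

Fixpoint gapped (g : seq bool -> nat) (pi : seq part) : bool :=
  if pi is (a, x) :: pi' then
    (g (x :: overlines pi') + head 1 (sizes pi') <= a) && gapped g pi'
  else true.

(** An excess at 1-based position k raises the first k parts alike, hence the factor k; [gap_weight]
    charges the forced gaps in the same way. *)
Fixpoint incr_weight (k : nat) (e : seq (nat * bool)) : nat :=
  if e is (d, _) :: e' then k * d + incr_weight k.+1 e' else 0.

Fixpoint gap_weight (g : seq bool -> nat) (k : nat) (b : seq bool) : nat :=
  if b is _ :: b' then k * g b + gap_weight g k.+1 b' else 0.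

Section Encoding.
Variable g : seq bool -> nat.

Lemma overlines_decode e : overlines (decode_gaps g e) = overlines e.
Proof. by elim: e => [|[d x] e IH] //=; congr (_ :: _). Qed.

Lemma gapped_decode e : gapped g (decode_gaps g e).
Proof.
by elim: e => [|[d x] e IH] //=; rewrite IH andbT overlines_decode leq_addl.
Qed.

Lemma decode_gapsK : cancel (decode_gaps g) (encode_gaps g).
Proof.
elim=> [|[d x] e IH] //=.
by rewrite IH overlines_decode addnK.
Qed.

Lemma encode_gapsK pi : gapped g pi -> decode_gaps g (encode_gaps g pi) = pi.
Proof.
elim: pi => [|[a x] pi IH] //= /andP[le_a /IH pi_eq].
by rewrite -(overlines_decode (encode_gaps g pi)) pi_eq subnK.
Qed.

Lemma head_sizes_decode e : 0 < head 1 (sizes (decode_gaps g e)).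
Proof. by elim: e => [|[d x] e IH] //=; rewrite !addn_gt0 IH !orbT. Qed.

(* Raising every index by [k] costs [k] times the total increment, which is the
   largest part minus one. *)
Lemma weight_decode_shift k e :
  weight (decode_gaps g e) + k * (head 1 (sizes (decode_gaps g e))).-1 =
  size e + incr_weight k.+1 e + gap_weight g k.+1 (overlines e).
Proof.
elim: e k => [|[d x] e IH] k /=; first by rewrite muln0.
have h1 := head_sizes_decode e.
rewrite /weight /= -/(weight (decode_gaps g e)) -/(overlines e).
have := IH k.+1; move: (gap_weight _ _ _) (incr_weight _ _) (weight _) => A B C.
move: (g _) (head _ _) h1 => G [//|h] _ /=.
nia.
Qed.

Lemma weight_decode e :
  weight (decode_gaps g e) = size e + incr_weight 1 e + gap_weight g 1 (overlines e).
Proof. by rewrite -(weight_decode_shift 0) mul0n addn0. Qed.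

Lemma gappedP pi :
  reflect (forall i, i < size pi ->
    g (drop i (overlines pi)) + nth 1 (sizes pi) i.+1 <= nth 1 (sizes pi) i)
    (gapped g pi).
Proof.
elim: pi => [|[a x] pi IH]; first by constructor.
apply: (iffP andP) => [[le_a /IH pi_g] [_|i lt_i]|pi_g]; first by case: pi {IH pi_g} le_a.
- exact: pi_g.
- split; first by have := pi_g 0 isT; rewrite /= nth0.
  by apply/IH => i lt_i; apply: (pi_g i.+1).
Qed.
End Encoding.

(** The default 1 stands for a virtual part after the last one, so the inequality at the last index
    is positivity of the last part, which monotonicity passes on to all parts. *)
Lemma is_partitionP s :
  reflect (forall i, i < size s -> nth 1 s i.+1 <= nth 1 s i) (is_partition s).
Proof.
elim: s => [|a s IH]; first by constructor.
have -> : is_partition (a :: s) = (head 1 s <= a) && is_partition s.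
  rewrite /is_partition /=; case: s {IH} => [|b s] /=; first by rewrite !andbT.
  case: (leqP b a) => // le_ba; rewrite /= !andbA.
  case: (0 < b) / idP => [b_gt0|//]; last by rewrite /= !andbF.
  by rewrite (leq_trans b_gt0 le_ba) !andbT.
apply: (iffP andP) => [[le_a /IH s_p] [_|i lt_i]|s_p]; first by rewrite /= nth0.
- exact: s_p.
- split; first by have := s_p 0 isT; rewrite /= nth0.
  by apply/IH => i lt_i; apply: (s_p i.+1).
Qed.

Lemma is_partition_nth s i j :
  is_partition s -> i <= j < size s -> nth 1 s j <= nth 1 s i.
Proof.
move/is_partitionP => s_p /andP[le_ij]; rewrite -(subnKC le_ij).
elim: (j - i) => [|k IH] lt_k; first by rewrite addn0.
apply: leq_trans (IH _); last by lia.
by rewrite addnS s_p //; lia.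
Qed.

Lemma nth_overlines_size (pi : seq part) i : nth false (overlines pi) i -> i < size pi.
Proof. by case: ltnP => // le_i; rewrite nth_default // size_map. Qed.

(** In a sorted list an overlined part is a first occurrence exactly when the part just before it,
    if any, is strictly larger; this is a forced gap of 1. *)
Lemma overpartition_firstE pi : overpartition_first pi = gapped gap_first pi.
Proof.
have size_s : size (sizes pi) = size pi by rewrite size_map.
have gapE i : gap_first (drop i (overlines pi)) = nth false (overlines pi) i.+1 :> nat.
  by rewrite /gap_first nth_drop addn1.
apply/idP/gappedP => [/andP[pi_p /forallP pi_o] i lt_i|pi_g].
  rewrite gapE; have le_i : nth 1 (sizes pi) i.+1 <= nth 1 (sizes pi) i.
    by apply/is_partitionP; rewrite ?size_s.
  case o_i: (nth false _ _); last by rewrite add0n.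
  have lt_i1 := nth_overlines_size o_i.
  have /implyP/(_ o_i) := pi_o (Ordinal lt_i1) => /=.
  (* Without the gap the two neighbours would be equal, and the overlined size would occur
     earlier. *)
  apply: contraR => nlt; apply/(nthP 1); exists i; first by rewrite size_takel ?size_s // ltnW.
  rewrite nth_take // (set_nth_default 1 0) ?size_s //.
  by apply/eqP; rewrite eqn_leq le_i andbT leqNgt -add1n.
have pi_p : is_partition (sizes pi).
  apply/is_partitionP => i; rewrite size_s => /pi_g; lia.
rewrite /overpartition_first pi_p; apply/forallP => -[i lt_i] /=.
apply/implyP; case: i lt_i => [|i] lt_i o_i; first by rewrite take0.
apply/(nthP 1) => -[j]; rewrite size_takel ?size_s; last by rewrite ltnW.
move=> lt_j; rewrite nth_take // (set_nth_default 1 0) ?size_s // => eq_ij.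
have := pi_g i (ltnW lt_i); rewrite gapE o_i add1n ltnNge -eq_ij.
by rewrite is_partition_nth // -ltnS lt_j size_s ltnW.
Qed.

Lemma gap_last_drop (b : seq bool) i :
  gap_last (drop i b) = nth false b i && (i.+1 < size b) :> nat.
Proof.
elim: b i => [|x b IH] [|i] //; last exact: IH.
by case: b {IH} => [|y b] /=; rewrite ?andbF ?andbT.
Qed.

(** Mirror image: an overlined part is a last occurrence exactly when the next part is strictly
    smaller; at the end of the list there is nothing to compare with. *)
Lemma overpartition_lastE pi : overpartition_last pi = gapped gap_last pi.
Proof.
have size_s : size (sizes pi) = size pi by rewrite size_map.
have size_o : size (overlines pi) = size pi by rewrite size_map.
apply/idP/gappedP => [/andP[pi_p /forallP pi_o] i lt_i|pi_g].
  rewrite gap_last_drop size_o; have le_i : nth 1 (sizes pi) i.+1 <= nth 1 (sizes pi) i.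
    by apply/is_partitionP; rewrite ?size_s.
  case o_i: (nth false _ _); last by rewrite add0n.
  case: ltnP => [lt_i1|]; last by [].
  have /implyP/(_ o_i) := pi_o (Ordinal lt_i) => /=.
  apply: contraR => nlt; apply/(nthP 1); exists 0; first by rewrite size_drop size_s subn_gt0.
  rewrite nth_drop addn0 (set_nth_default 1 0) ?size_s //.
  by apply/eqP; rewrite eqn_leq le_i leqNgt -add1n.
have pi_p : is_partition (sizes pi).
  apply/is_partitionP => i; rewrite size_s => /pi_g; lia.
rewrite /overpartition_last pi_p; apply/forallP => -[i lt_i] /=.
apply/implyP => o_i.
apply/(nthP 1) => -[j]; rewrite size_drop size_s ltn_subRL => lt_j.
rewrite nth_drop (set_nth_default 1 0) ?size_s // => eq_ij.
have := pi_g i lt_i; rewrite gap_last_drop size_o o_i (leq_ltn_trans (leq_addr _ _) lt_j).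
by rewrite add1n -eq_ij ltnNge is_partition_nth // leq_addr size_s.
Qed.

Local Open Scope classical_set_scope.
Local Open Scope ring_scope.

(** * Binary words *)

Fixpoint bits (m : nat) : seq (seq bool) :=
  if m is m'.+1 then map (cons false) (bits m') ++ map (cons true) (bits m')
  else [:: [::]].

Fixpoint pos_sum (k : nat) (b : seq bool) : nat :=
  if b is x :: b' then x * k + pos_sum k.+1 b' else 0%N.

Lemma mem_bits m b : (b \in bits m) = (size b == m).
Proof.
have notin (x y : bool) b' s : x != y -> (x :: b' \in map (cons y) s) = false.
  by move=> neq_xy; apply/mapP => -[c _ [eq_xy]]; rewrite eq_xy eqxx in neq_xy.
have consI x : injective (@cons bool x) by move=> ? ? [].
elim: m b => [|m IH] [|x b] //=.
  by rewrite mem_cat; apply/norP; split; apply/mapP => -[].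
case: x; rewrite mem_cat.
  by rewrite (notin true false) // (mem_map (consI true) _ b) IH.
by rewrite (notin false true) // orbF (mem_map (consI false) _ b) IH.
Qed.

Lemma uniq_bits m : uniq (bits m).
Proof.
elim: m => [|m IH] //=; rewrite cat_uniq !map_inj_uniq ?IH ?andbT => [|? ? []|? ? []] //=.
by apply/hasPn => _ /mapP[b _ ->]; apply/mapP => -[].
Qed.

Section BigBits.
Variable V : nmodType.
Implicit Types (P : pred (seq bool)) (F : seq bool -> V).

Lemma big_bitsS m P F :
  \sum_(b <- bits m.+1 | P b) F b =
  \sum_(b <- bits m | P (false :: b)) F (false :: b) +
  \sum_(b <- bits m | P (true :: b)) F (true :: b).
Proof. by rewrite big_cat !big_map. Qed.

Lemma big_bits_rev m P F :
  \sum_(b <- bits m | P b) F b = \sum_(b <- bits m | P (rev b)) F (rev b).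
Proof.
rewrite -[RHS](big_map rev P F); apply: perm_big; apply: uniq_perm.
- exact: uniq_bits.
- by rewrite map_inj_uniq ?uniq_bits //; apply: can_inj (@revK _).
move=> b; rewrite mem_bits -[b in RHS]revK (mem_map (can_inj (@revK _))).
by rewrite mem_bits size_rev.
Qed.

Lemma big_bitsS_rcons m P F :
  \sum_(b <- bits m.+1 | P b) F b =
  \sum_(b <- bits m | P (rcons b false)) F (rcons b false) +
  \sum_(b <- bits m | P (rcons b true)) F (rcons b true).
Proof.
rewrite big_bits_rev big_bitsS; congr (_ + _); rewrite [RHS]big_bits_rev;
by apply: eq_big => b; rewrite rev_cons.
Qed.

(** A word is all zeros or has the form 0^c 1 b. A first letter 0 lengthens the leading run by one;
    a first letter 1 is the case c = 0. *)
Lemma big_bits_leading m P F :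
  \sum_(b <- bits m | P b) F b =
  (if P (nseq m false) then F (nseq m false) else 0) +
  \sum_(0 <= c < m) \sum_(b <- bits (m - c.+1) | P (nseq c false ++ true :: b))
     F (nseq c false ++ true :: b).
Proof.
elim: m P F => [|m IH] P F; first by rewrite big_nil addr0 big_cons big_nil addr0.
rewrite big_bitsS IH big_nat_recl // -addrA [X in _ + X]addrC; congr (_ + (_ + _)).
by rewrite subSS subn0.
Qed.

Lemma big_bits_trailing m P F :
  \sum_(b <- bits m | P b) F b =
  (if P (nseq m false) then F (nseq m false) else 0) +
  \sum_(0 <= j < m) \sum_(b <- bits (m - j.+1) | P (b ++ true :: nseq j false))
     F (b ++ true :: nseq j false).
Proof.
rewrite big_bits_rev big_bits_leading rev_nseq; congr (_ + _).
apply: eq_bigr => j _; rewrite [RHS]big_bits_rev; apply: eq_big => b;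
  by rewrite rev_cat rev_nseq rev_cons cat_rcons.
Qed.

Lemma big_bits_count m P F :
  \sum_(b <- bits m | P b) F b =
  \sum_(0 <= s < m.+1) \sum_(b <- bits m | P b && (count id b == s)) F b.
Proof.
rewrite (exchange_big_dep P) => [|s b _ /andP[]//] /=.
rewrite big_seq_cond [RHS]big_seq_cond; apply: eq_bigr => b /andP[].
rewrite mem_bits => /eqP size_b Pb.
have mem_s : count id b \in index_iota 0 m.+1.
  by rewrite mem_index_iota ltnS -size_b count_size.
rewrite big_mkcond (bigD1_seq _ mem_s (iota_uniq _ _)) /= eqxx Pb.
by rewrite big1 ?addr0 // => s /negPf; rewrite eq_sym => ->.
Qed.

Lemma big_bits_count_gt m s P F : (m < s)%N ->
  \sum_(b <- bits m | P b && (count id b == s)) F b = 0.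
Proof.
move=> lt_ms; rewrite big_seq_cond big_pred0 // => b.
rewrite mem_bits; apply/negP => /andP[/eqP size_b /andP[_ /eqP count_b]].
by have := count_size id b; rewrite size_b count_b leqNgt lt_ms.
Qed.

Lemma big_bits_count0 m P F :
  \sum_(b <- bits m | P b && (count id b == 0%N)) F b =
  if P (nseq m false) then F (nseq m false) else 0.
Proof.
rewrite big_bits_leading count_nseq eqxx andbT big1 ?addr0 // => c _.
by rewrite big_pred0 // => b; rewrite count_cat /= !addnS andbF.
Qed.
End BigBits.

(** * Position sums and forbidden patterns of binary words *)

Lemma pos_sumS k b : pos_sum k.+1 b = (pos_sum k b + count id b)%N.
Proof. by elim: b k => //= x b IH k; rewrite IH; nia. Qed.

Lemma pos_sumD k b : pos_sum k b = (pos_sum 0 b + k * count id b)%N.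
Proof. by elim: k => [|k IH]; rewrite ?addn0 // pos_sumS IH mulSn; lia. Qed.

Lemma pos_sum_cat k b c : pos_sum k (b ++ c) = (pos_sum k b + pos_sum (k + size b) c)%N.
Proof. by elim: b k => [|x b IH] k /=; rewrite ?addn0 // IH addSnnS addnA. Qed.

Lemma pos_sum_nseq k n : pos_sum k (nseq n false) = 0%N.
Proof. by elim: n k => //= n IH k; rewrite IH. Qed.

Lemma count_nseq_false n : count id (nseq n false) = 0%N.
Proof. by rewrite count_nseq. Qed.

(** The gap at the k-th part is the overline of the next part, whose 0-based position is k. *)
Lemma gap_weight_first b : gap_weight gap_first 1 b = pos_sum 0 b.
Proof.
(* For the induction: the first letter sits at position k but is charged by no gap of the word
   itself. The correction vanishes at k = 0. *)
suff shift k : (gap_weight gap_first k.+1 b + k * head false b = pos_sum k b)%N.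
  by rewrite -shift mul0n addn0.
elim: b k => [|x b IH] k /=; first by rewrite muln0.
by rewrite -IH /gap_first /= nth0; nia.
Qed.

(** Every letter but the last is its own gap and the last one is free, which is why words are split
    at their end in this convention. *)
Lemma gap_weight_last k b x : gap_weight gap_last k (rcons b x) = pos_sum k b.
Proof.
elim: b k => [|y b IH] k /=; first by rewrite muln0.
by rewrite IH; case: b {IH} => [|? b] /=; rewrite mulnC.
Qed.

Lemma infix_tt_cons x b :
  infix [:: true; true] (x :: b) = (x && head false b) || infix [:: true; true] b.
Proof. by case: x b => [] [|[] b] /=; rewrite ?prefix0s. Qed.

Lemma infix_tt_rcons b x :
  infix [:: true; true] (rcons b x) = (x && last false b) || infix [:: true; true] b.
Proof.
rewrite -infix_rev rev_rcons infix_tt_cons -(infix_rev _ b).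
by case/lastP: b => [|b y] //; rewrite rev_rcons last_rcons.
Qed.

Lemma prefix_false_nseq r n b :
  prefix (nseq r false) (nseq n false ++ true :: b) = (r <= n)%N.
Proof. by elim: r n => [|r IH] [|n] //=; rewrite IH. Qed.

Lemma infix_false_nseq r n : infix (nseq r false) (nseq n false) = (r <= n)%N.
Proof.
apply/idP/idP => [/size_infix|le_rn]; first by rewrite !size_nseq.
by rewrite -(subnKC le_rn) nseqD prefix_infix.
Qed.

(** A run of zeros cannot straddle the displayed one, so it lies in the leading block or in [b]. *)
Lemma infix_false_leading r c b : (0 < r)%N ->
  infix (nseq r false) (nseq c false ++ true :: b) =
  (r <= c)%N || infix (nseq r false) b.
Proof.
move=> r_gt0; elim: c => [|c IH]; first by case: r r_gt0.
rewrite -[LHS]/(prefix _ (nseq c.+1 false ++ _) || infix _ (nseq c false ++ _)).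
by rewrite IH prefix_false_nseq orbA; case: (leqP r c) => [/leqW ->|_]; rewrite ?orbF.
Qed.

Lemma infix_false_trailing r b j : (0 < r)%N ->
  infix (nseq r false) (b ++ true :: nseq j false) =
  (r <= j)%N || infix (nseq r false) b.
Proof.
move=> r_gt0; rewrite -infix_rev rev_nseq rev_cat rev_cons rev_nseq cat_rcons.
by rewrite infix_false_leading // -infix_revLR rev_nseq.
Qed.

(** * Gaussian binomial coefficients *)

Section QBinomial.
Variables (R : realType) (q : R[i]).
Hypothesis hq : `|q| < 1.

Lemma one_sub_expr_neq0 n : 1 - q ^+ n.+1 != 0.
Proof.
rewrite subr_eq0; apply/eqP => q_eq1.
have := exprn_ilt1 n.+1 (normr_ge0 q) hq.
by rewrite -normrX -q_eq1 normr1 ltxx.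
Qed.

Lemma qpochS (x : R[i]) n : qpoch x x n.+1 = qpoch x x n * (1 - x ^+ n.+1).
Proof. by rewrite /qpoch big_ord_recr exprS. Qed.

Lemma qpoch_neq0 k n : (0 < k)%N -> qpoch (q ^+ k) (q ^+ k) n != 0.
Proof.
case: k => // k _; elim: n => [|n IH]; first by rewrite /qpoch big_ord0 oner_neq0.
rewrite qpochS mulf_neq0 // -exprM mulSn addSn; exact: one_sub_expr_neq0.
Qed.

Lemma qbinom_lt k (A B : int) : A < B -> qbinom q k A B = 0.
Proof. by move=> ltAB; rewrite /qbinom; case: ifP => // /andP[_]; rewrite leNgt ltAB. Qed.

(** Writing the upper index as b + a removes the case distinction and the absolute values of
    [qbinom], so that the Pascal rules become rational identities. *)
Lemma qbinom_addn k (a b : nat) : qbinom q k (b + a)%N b =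
  qpoch (q ^+ k) (q ^+ k) (b + a) / (qpoch (q ^+ k) (q ^+ k) b * qpoch (q ^+ k) (q ^+ k) a).
Proof.
rewrite /qbinom lez_nat leq_addr /=.
by have -> : `|(b + a)%N%:Z - b%:Z|%N = a by lia.
Qed.

Lemma qbinom_addSn k (a b : nat) : qbinom q k (b.+1 + a)%N b =
  qpoch (q ^+ k) (q ^+ k) (b.+1 + a) /
    (qpoch (q ^+ k) (q ^+ k) b * qpoch (q ^+ k) (q ^+ k) a.+1).
Proof. by rewrite addSnnS qbinom_addn. Qed.

Lemma qbinom0 k (A : int) : (0 < k)%N -> 0 <= A -> qbinom q k A 0%N = 1.
Proof.
case: A => // a k_gt0 _; rewrite -[a]add0n (qbinom_addn k a 0) {2}/qpoch big_ord0 mul1r.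
by rewrite divff // qpoch_neq0.
Qed.

Lemma qbinom_nn k (a : nat) : (0 < k)%N -> qbinom q k a a = 1.
Proof.
move=> k_gt0; rewrite -{1}[a]addn0 qbinom_addn addn0.
by rewrite {3}/qpoch big_ord0 mulr1 divff // qpoch_neq0.
Qed.

(** The upper index is an integer because the alternating sums below use the rule at n - r i, which
    may be negative; for A < B all terms vanish. *)
Lemma qbinom_pascal k (A : int) (B : nat) : (0 < k)%N ->
  qbinom q k (A + 1) B.+1 = q ^+ (k * B.+1) * qbinom q k A B.+1 + qbinom q k A B.
Proof.
move=> k_gt0; case: (ltrgtP A B%:Z) => [ltAB|gtAB|->].
- by rewrite !qbinom_lt ?mulr0 ?addr0 //; lia.
- have [a ->] : exists a : nat, A = (B.+1 + a)%N by exists `|A - B.+1%:Z|%N; lia.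
  have -> : (B.+1 + a)%N%:Z + 1 = (B.+1 + a.+1)%N by lia.
  rewrite !qbinom_addn qbinom_addSn addnS !qpochS !exprM -addnS exprD.
  have := qpoch_neq0 B k_gt0.
  have := qpoch_neq0 a k_gt0.
  have := qpoch_neq0 a.+1 k_gt0; have := qpoch_neq0 B.+1 k_gt0.
  rewrite !qpochS !mulf_eq0 !negb_or => /andP[_ B1] /andP[_ a1] a0 B0.
  field.
  by rewrite a0 B0 a1 B1.
- rewrite [qbinom q k B B.+1]qbinom_lt ?mulr0 ?add0r; last by lia.
  by rewrite intS addrC -intS !qbinom_nn.
Qed.

(** Companion rule with the power of q on the other term; it is applied in base q^r to the first
    binomial of [run_sum]. *)
Lemma qbinom_pascal_r k (A B : nat) : (0 < k)%N ->
  qbinom q k A.+1 B.+1 = qbinom q k A B.+1 + q ^+ (k * (A - B)) * qbinom q k A B.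
Proof.
move=> k_gt0; case: (ltngtP A B) => [ltAB|gtAB|->].
- by rewrite !qbinom_lt ?mulr0 ?addr0 //; lia.
- have [a ->] : exists a : nat, A = (B.+1 + a)%N by exists (A - B.+1)%N; lia.
  have -> : (B.+1 + a - B = a.+1)%N by lia.
  rewrite -addnS !qbinom_addn qbinom_addSn addnS !qpochS !exprM -addnS exprD.
  have := qpoch_neq0 B k_gt0.
  have := qpoch_neq0 a k_gt0.
  have := qpoch_neq0 a.+1 k_gt0; have := qpoch_neq0 B.+1 k_gt0.
  rewrite !qpochS !mulf_eq0 !negb_or => /andP[_ B1] /andP[_ a1] a0 B0.
  field.
  by rewrite a0 B0 a1 B1.
- by rewrite [qbinom q k B B.+1]qbinom_lt ?ltz_nat // add0r !qbinom_nn // subnn muln0 mul1r.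
Qed.
End QBinomial.

(** * Weighted counts of binary words *)

Lemma count_rcons (T : Type) (a : pred T) s x :
  count a (rcons s x) = (count a s + a x)%N.
Proof. by rewrite -cats1 count_cat /= addn0. Qed.

Section BitSums.
Variables (R : realType) (q : R[i]).
Hypothesis hq : `|q| < 1.

Definition bit_sum (good : pred (seq bool)) (k m s : nat) : R[i] :=
  \sum_(b <- bits m | good b && (count id b == s)) q ^+ pos_sum k b.

Lemma bit_sum_shift good k m s : bit_sum good k m s = q ^+ (k * s) * bit_sum good 0 m s.
Proof.
rewrite /bit_sum big_distrr; apply: eq_bigr => b /andP[_ /eqP count_b].
by rewrite pos_sumD count_b addnC exprD.
Qed.

(** * Words without two adjacent ones *)

Definition no_tt (b : seq bool) := ~~ infix [:: true; true] b.

(** The word starts with 0 or with 10. Deleting this prefix moves the remaining ones by 1 or by 2,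
    whence q^(s+1) and q^(2s); the deleted one sits at position 0. *)
Lemma bit_sum_no_tt_rec m s :
  bit_sum no_tt 0 m.+2 s.+1 =
  q ^+ s.+1 * bit_sum no_tt 0 m.+1 s.+1 + q ^+ (2 * s) * bit_sum no_tt 0 m s.
Proof.
rewrite {1}/bit_sum big_bitsS; congr (_ + _).
  transitivity (bit_sum no_tt 1 m.+1 s.+1); last by rewrite bit_sum_shift mul1n.
  by apply: eq_bigl => b; rewrite /no_tt infix_tt_cons.
rewrite big_bitsS [X in _ + X]big_pred0 ?addr0; last first.
  by move=> b; rewrite /no_tt infix_tt_cons.
rewrite -bit_sum_shift; apply: eq_bigl => b.
by rewrite /no_tt !infix_tt_cons.
Qed.

Lemma bit_sum_eq0 good k m s : (m < s)%N -> bit_sum good k m s = 0.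
Proof. exact: big_bits_count_gt. Qed.

Lemma bit_sum0 good k m : bit_sum good k m 0 = (good (nseq m false))%:R.
Proof. by rewrite /bit_sum big_bits_count0 pos_sum_nseq; case: ifP. Qed.

Lemma no_tt_nseq m : no_tt (nseq m false).
Proof. by elim: m => //= m IH; rewrite /no_tt infix_tt_cons. Qed.

(** The recursion is the q-Pascal rule once the power of q is factored out, since (s+1)s = 2s + (s^2
    - s). *)
Lemma bit_sum_no_tt m s :
  bit_sum no_tt 0 m s = q ^+ (s * s - s) * qbinom q 1 (m%:Z - s%:Z + 1) s%:Z.
Proof.
elim/ltn_ind: m s => -[|[|m]] IH [|s]; rewrite ?bit_sum0 ?no_tt_nseq ?mul0n ?sub0n ?expr0.
1,3,5: by rewrite qbinom0 ?mul1r //; lia.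
- by rewrite bit_sum_eq0 // qbinom_lt ?mulr0 //; lia.
- case: s => [|s]; last by rewrite bit_sum_eq0 // qbinom_lt ?mulr0 //; lia.
  rewrite /bit_sum /= !big_cons big_nil /= mul1n addr0.
  by rewrite -[X in qbinom _ _ X _]/(1%N%:Z) qbinom_nn ?mulr1.
rewrite bit_sum_no_tt_rec !IH //.
have -> : m%:Z - s%:Z + 1 = m.+1%:Z - s.+1%:Z + 1 by lia.
have -> : m.+2%:Z - s.+1%:Z + 1 = (m.+1%:Z - s.+1%:Z + 1) + 1 by lia.
have -> : (s.+1 * s.+1 - s.+1 = 2 * s + (s * s - s))%N by nia.
by rewrite [in RHS]qbinom_pascal // mul1n exprD; ring.
Qed.

(** * Words without r consecutive zeros *)

Section NoRun.
Variable r : nat.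
Hypothesis r_gt0 : (0 < r)%N.

Definition no_run (b : seq bool) := ~~ infix (nseq r false) b.

(** Coefficient of x^(n-s) in G_s = prod_(k <= s) (1 - (x q^k)^r) / (1 - x q^k): the numerator
    expands in base q^r, the inverse of the denominator in base q. An integer n lets the recursions
    step below 0. *)
Definition run_sum (s : nat) (n : int) : R[i] :=
  \sum_(0 <= i < s.+2) (-1) ^+ i * q ^+ (r * 'C(i, 2)) *
     qbinom q r s.+1 i * qbinom q 1 (n - r%:Z * i%:Z) s.

Lemma run_sum_lt s (n : int) : n < s%:Z -> run_sum s n = 0.
Proof.
move=> lt_ns; rewrite /run_sum big1 // => i _.
by rewrite [qbinom q 1 _ _]qbinom_lt ?mulr0 //; nia.
Qed.

(** For s = 0 the product is (1 - x^r) / (1 - x) = 1 + x + ... + x^(r-1). *)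
Lemma run_sum0 (m : nat) : run_sum 0 m = (m < r)%N%:R.
Proof.
rewrite /run_sum !big_nat_recr //= big_nil add0r expr0 mul1r muln0 mulr0 subr0 expr1.
rewrite qbinom0 // qbinom_nn // !mul1r !mulr1 [X in X + _]qbinom0 // ?muln0 ?expr0 ?mulr1 ?mulN1r.
case: ltnP => le_rm; first by rewrite qbinom_lt ?subr0 //; lia.
by rewrite qbinom0 ?subrr //; lia.
Qed.

(** Coefficientwise form of (1 - x q^(s+1)) G_(s+1) = (1 - (x q^(s+1))^r) G_s. *)
Lemma run_sumS_diff s (n : int) :
  run_sum s.+1 (n + 1) - q ^+ s.+1 * run_sum s.+1 n =
  run_sum s n - q ^+ (r * s.+1) * run_sum s (n - r%:Z).
Proof.
(* The Pascal rule in base q lowers the second binomial from s+1 to s. *)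
have -> : run_sum s.+1 (n + 1) - q ^+ s.+1 * run_sum s.+1 n =
    \sum_(0 <= i < s.+3) (-1) ^+ i * q ^+ (r * 'C(i, 2)) *
      qbinom q r s.+2 i * qbinom q 1 (n - r%:Z * i%:Z) s.
  rewrite /run_sum big_distrr -sumrB; apply: eq_bigr => i _.
  have -> : n + 1 - r%:Z * i%:Z = n - r%:Z * i%:Z + 1 by lia.
  by rewrite qbinom_pascal // mul1n /=; ring.
have -> : run_sum s n = \sum_(0 <= i < s.+3) (-1) ^+ i * q ^+ (r * 'C(i, 2)) *
    qbinom q r s.+1 i * qbinom q 1 (n - r%:Z * i%:Z) s.
  by rewrite [RHS]big_nat_recr //= [qbinom q r _ s.+2]qbinom_lt ?ltz_nat // mulr0 mul0r addr0.
(* Past the term i = 0, the companion rule in base q^r splits the first binomial; its second part is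
   the sum shifted by one in i. *)
rewrite big_nat_recl // [in RHS]big_nat_recl // !qbinom0 // -addrA; congr (_ + _).
rewrite /run_sum big_distrr -sumrB /=; apply: eq_big_nat => i /andP[_ lt_i].
have -> : n - r%:Z - r%:Z * i%:Z = n - r%:Z * i.+1%:Z by lia.
rewrite qbinom_pascal_r // binS bin1 mulnDr exprD exprS.
have -> : (r * s.+1 = r * (s.+1 - i) + r * i)%N by nia.
by rewrite exprD; ring.
Qed.

(** Coefficientwise form of G_(s+1) = G_s sum_(c < r) (x q^(s+1))^c. *)
Lemma run_sum_rec s (m : nat) :
  run_sum s.+1 m = \sum_(0 <= c < r) q ^+ (c * s.+1) * run_sum s (m%:Z - 1 - c%:Z).
Proof.
elim: m => [|m IH].
  by rewrite run_sum_lt // big1 // => c _; rewrite run_sum_lt ?mulr0 //; lia.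
have -> : run_sum s.+1 m.+1 = q ^+ s.+1 * run_sum s.+1 m +
    (run_sum s m - q ^+ (r * s.+1) * run_sum s (m%:Z - r%:Z)).
  rewrite -run_sumS_diff; have -> : m.+1%:Z = m%:Z + 1 by lia.
  by rewrite [RHS]addrC subrK.
pose T c := q ^+ (c * s.+1) * run_sum s (m%:Z - c%:Z).
have -> : run_sum s m = T 0%N by rewrite /T mul0n mul1r subr0.
rewrite -/(T r) IH big_distrr /=.
have -> : \sum_(0 <= c < r) q ^+ s.+1 * (q ^+ (c * s.+1) * run_sum s (m%:Z - 1 - c%:Z)) =
    \sum_(0 <= c < r) T c.+1.
  apply: eq_bigr => c _; rewrite /T mulrA -exprD mulSn; congr (_ * run_sum _ _); lia.
have -> : \sum_(0 <= c < r) q ^+ (c * s.+1) * run_sum s (m.+1%:Z - 1 - c%:Z) =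
    \sum_(0 <= c < r) T c.
  by apply: eq_bigr => c _; rewrite /T; congr (_ * run_sum _ _); lia.
(* The sums of T c and of T (c+1) over c < r differ by T 0 - T r. *)
by apply/eqP; rewrite addrA subr_eq addrC -big_nat_recl // big_nat_recr.
Qed.

(** Write the word as 0^c 1 b with c < r: its first one sits at c, and the s ones of b are counted
    from c + 1. *)
Lemma bit_sum_no_run_rec m s : bit_sum no_run 0 m s.+1 =
  \sum_(0 <= c < m | (c < r)%N) q ^+ (c + c.+1 * s) * bit_sum no_run 0 (m - c.+1) s.
Proof.
rewrite {1}/bit_sum big_bits_leading count_nseq_false andbF add0r [RHS]big_mkcond.
apply: eq_bigr => c _; case: ltnP => [lt_cr|le_rc]; last first.
  by rewrite big_pred0 // => b; rewrite /no_run infix_false_leading // le_rc.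
rewrite exprD -mulrA -bit_sum_shift /bit_sum big_distrr /=; apply: eq_big => b.
  rewrite /no_run infix_false_leading // leqNgt lt_cr /=.
  by rewrite count_cat count_nseq_false /= eqSS.
by move=> _; rewrite -exprD pos_sum_cat pos_sum_nseq size_nseq /= mul1n.
Qed.

Lemma bit_sum_no_run m s : bit_sum no_run 0 m s = q ^+ 'C(s, 2) * run_sum s m.
Proof.
elim: s m => [|s IH] m.
  by rewrite bit_sum0 /no_run infix_false_nseq run_sum0 mul1r ltnNge.
rewrite bit_sum_no_run_rec run_sum_rec big_distrr /=.
pose T c := q ^+ 'C(s.+1, 2) * (q ^+ (c * s.+1) * run_sum s (m%:Z - 1 - c%:Z)).
transitivity (\sum_(0 <= c < m | (c < r)%N) T c).
  rewrite big_nat_cond [RHS]big_nat_cond.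
  apply: eq_bigr => c /andP[/andP[_ lt_cm] _]; rewrite IH /T !mulrA -!exprD.
  by rewrite binS bin1; congr (q ^+ _ * run_sum _ _); nia.
(* One sum runs over c below both m and r, the other over c < r alone; the extra terms vanish
   because their index m - 1 - c is negative. *)
have T0 c : (m <= c)%N -> T c = 0 by move=> le_mc; rewrite /T run_sum_lt ?mulr0 //; lia.
rewrite (big_nat_widen _ _ _ _ _ (leq_maxl m r)).
rewrite [RHS](big_nat_widen _ _ _ _ _ (leq_maxr m r)).
rewrite big_mkcond [RHS]big_mkcond; apply: eq_bigr => c _ /=.
by case: (ltnP c r); case: (ltnP c m) => //= /T0.
Qed.
End NoRun.

(** A last letter 0 leaves a word counted from position 1. A last letter 1 costs nothing and, unless
    it is the whole word, must follow a 0. *)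
Lemma last_bit_sum_no_tt m s :
  \sum_(b <- bits m.+1 | no_tt b && (count id b == s)) q ^+ gap_weight gap_last 1 b =
  (if s is s'.+1 then q ^+ (s' * s') * qbinom q 1 (m%:Z - s'%:Z) s' else 0) +
  q ^+ (s * s) * qbinom q 1 (m.+1%:Z - s%:Z) s.
Proof.
rewrite big_bitsS_rcons addrC; congr (_ + _); last first.
  transitivity (bit_sum no_tt 1 m s).
    apply: eq_big => b; last by rewrite gap_weight_last.
    by rewrite /no_tt infix_tt_rcons count_rcons addn0.
  rewrite bit_sum_shift bit_sum_no_tt mul1n mulrA -exprD.
  by congr (q ^+ _ * qbinom _ _ _ _); nia.
case: s => [|s].
  by rewrite big_pred0 // => b; rewrite count_rcons addn1 andbF.
case: m => [|m].
  rewrite big_cons big_nil /= addr0; case: s => [|s] /=; first by rewrite mul1r qbinom0.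
  by rewrite qbinom_lt ?mulr0 //; lia.
rewrite big_bitsS_rcons [X in _ + X]big_pred0 ?addr0; last first.
  by move=> b; rewrite /no_tt infix_tt_rcons last_rcons.
transitivity (bit_sum no_tt 1 m s).
  apply: eq_big => b; first by rewrite /no_tt !infix_tt_rcons last_rcons !count_rcons addn0 addn1.
  by move=> _; rewrite gap_weight_last -cats1 pos_sum_cat addn0.
rewrite bit_sum_shift bit_sum_no_tt mul1n mulrA -exprD.
by congr (q ^+ _ * qbinom _ _ _ _); nia.
Qed.

(** Write the word as b 1 0^j with j < r. For j = 0 the displayed one is free; otherwise its
    position m + 1 - j is charged. Counting the s ones of b from 1 turns q^C(s,2) into
    q^C(s+1,2). *)
Lemma last_bit_sum_no_run r m s : (0 < r)%N ->
  \sum_(b <- bits m.+1 | no_run r b && (count id b == s.+1)) q ^+ gap_weight gap_last 1 b =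
  q ^+ 'C(s.+1, 2) * (run_sum r s m +
    \sum_(1 <= j < r | (j <= m)%N) q ^+ (m.+1 - j) * run_sum r s (m%:Z - j%:Z)).
Proof.
move=> r_gt0; rewrite big_bits_trailing count_nseq_false andbF add0r big_nat_recl //.
rewrite mulrDr subSS subn0; congr (_ + _).
  transitivity (bit_sum (no_run r) 1 m s).
    apply: eq_big => b; last by rewrite [nseq 0 _]/= cats1 gap_weight_last.
    by rewrite /no_run infix_false_trailing // leqNgt r_gt0 count_cat addn1.
  by rewrite bit_sum_shift bit_sum_no_run // mul1n mulrA -exprD binS bin1 addnC.
rewrite [RHS]big_distrr [RHS]/=.
pose T j := q ^+ 'C(s.+1, 2) * (q ^+ (m.+1 - j) * run_sum r s (m%:Z - j%:Z)).
transitivity (\sum_(1 <= j < m.+1 | (j < r)%N) T j).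
  rewrite big_add1 -pred_Sn [RHS]big_mkcond; apply: eq_big_nat => j /andP[_ lt_jm].
  case: ltnP => [lt_jr|le_rj]; last first.
    by rewrite big_pred0 // => b; rewrite /no_run infix_false_trailing // le_rj.
  transitivity (\sum_(b <- bits (m - j.+1) | no_run r b && (count id b == s))
      q ^+ (m - j) * q ^+ pos_sum 1 b).
    rewrite big_seq_cond [RHS]big_seq_cond subSS.
    apply: eq_big => b.
      rewrite /no_run infix_false_trailing // leqNgt lt_jr /=.
      by rewrite count_cat /= count_nseq_false addn1.
    rewrite mem_bits => /andP[/eqP size_b _].
    (* The trailing run is nonempty here, so the free last letter is a 0 and every one is
       charged. *)
    have -> : b ++ true :: nseq j.+1 false = rcons (b ++ true :: nseq j false) false.
      by rewrite -cats1 -catA /= -[nseq j false ++ _]/(nseq j false ++ nseq 1 false) -nseqD addn1.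
    rewrite gap_weight_last pos_sum_cat /= pos_sum_nseq addn0 -exprD size_b.
    by congr (q ^+ _); lia.
  rewrite -big_distrr -/(bit_sum _ _ _ _) bit_sum_shift bit_sum_no_run // /T /=.
  by rewrite -subzn // subSS binS bin1 exprD mul1n; ring.
rewrite (big_nat_widen _ _ _ _ _ (leq_maxl m.+1 r)).
rewrite [RHS](big_nat_widen _ _ _ _ _ (leq_maxr m.+1 r)).
by apply: eq_bigl => j; rewrite ltnS andbC.
Qed.
End BitSums.

(** * Unordered sums and limits *)

Lemma ler_sum_subset (K : numDomainType) (T : eqType) (A B : seq T) (h : T -> K) :
  uniq A -> uniq B -> {subset A <= B} -> (forall x, 0 <= h x) ->
  \sum_(x <- A) h x <= \sum_(x <- B) h x.
Proof.
move=> uA uB AB h_ge0.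
have -> : \sum_(x <- A) h x = \sum_(x <- B | x \in A) h x.
  rewrite -[RHS]big_filter (perm_big [seq x <- B | x \in A]) //.
  apply: uniq_perm; rewrite ?filter_uniq // => x.
  by rewrite mem_filter; case: (boolP (x \in A)) => // /AB ->.
by rewrite big_mkcond; apply: ler_sum => x _; case: ifP.
Qed.

Lemma partial_sumE (I : choiceType) (V : zmodType) (x : I -> V) (A : {fset I}) :
  summability.partial_sum x A = \sum_(i <- A) x i.
Proof. by rewrite /summability.partial_sum -(big_seq_fsetE _ _ xpredT). Qed.

#[local] Existing Instance summability.totally_filter.

Section UnorderedSums.
Variables (R : realType) (I : choiceType).

(** The partial sums increase with the finite set, so they converge to their supremum. *)
Lemma cvg_partial_sum_ge0 (g : I -> R) (C : R) : (forall i, 0 <= g i) ->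
  (forall A : {fset I}, \sum_(i <- A) g i <= C) ->
  cvg (summability.partial_sum g @ summability.totally).
Proof.
move=> g_ge0 g_le; set u := summability.partial_sum g.
have has_sup_u : has_sup (range u).
  split; first by exists (u fset0), fset0.
  by exists C => _ [A _ <-]; rewrite /u partial_sumE.
apply/cvg_ex; exists (sup (range u)); apply/cvgrPdist_lt => e e_gt0.
have [_ [A0 _ <-] lt_A0] := sup_adherent e_gt0 has_sup_u.
exists A0 => // A /= /fsubsetP le_A.
have le_u : u A0 <= u A.
  by rewrite /u !partial_sumE ler_sum_subset.
have u_le : u A <= sup (range u) by apply: ub_le_sup; [case: has_sup_u|exists A].
rewrite ger0_norm ?subr_ge0 //; lra.
Qed.

Lemma cvg_Complex (T : Type) (F : set_system T) (FF : Filter F) (u v : T -> R) (a b : R) :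
  u @ F --> a -> v @ F --> b ->
  (Complex (u t) (v t) : R[i]^o) @[t --> F] --> (Complex a b : R[i]^o).
Proof.
move=> /cvgrPdist_lt ua /cvgrPdist_lt vb; apply/cvgrPdist_lt => -[e e'].
(* A positive element of R[i] is real, so the radius reduces to its real part. *)
rewrite ltcE /= => /andP[/eqP -> e_gt0].
have e2 : 0 < e / 2 by lra.
near=> t.
have -> : Complex a b - Complex (u t) (v t) =
    real_complex R (a - u t) + Complex 0 1 * real_complex R (b - v t).
  by apply/eqP; rewrite eq_complex /=; apply/andP; split; apply/eqP; ring.
have norm_real (x : R) : `|real_complex R x| = real_complex R `|x|.
  by rewrite normc_def /= expr0n addr0 sqrtr_sqr.
apply: le_lt_trans (ler_normD _ _) _; rewrite normrM !norm_real normc_def /=.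
rewrite expr0n expr1n add0r sqrtr1 mul1r -rmorphD -[Complex e 0]/(real_complex R e) ltcR.
rewrite (splitr e) ltrD //; by [near: t; exact: ua|near: t; exact: vb].
Unshelve. all: by end_near. Qed.

Lemma Re_sum (A : seq I) (f : I -> R[i]) :
  complex.Re (\sum_(i <- A) f i) = \sum_(i <- A) complex.Re (f i).
Proof. by apply: (big_morph (@complex.Re R)) => // -[? ?] [? ?]. Qed.

Lemma Im_sum (A : seq I) (f : I -> R[i]) :
  complex.Im (\sum_(i <- A) f i) = \sum_(i <- A) complex.Im (f i).
Proof. by apply: (big_morph (@complex.Im R)) => // -[? ?] [? ?]. Qed.

(** Real and imaginary parts are dominated by the norm N. A real family h with |h| <= N converges as
    the difference of h + N and N, both nonnegative with bounded sums. *)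
Lemma cvg_partial_sum (f : I -> R[i]) (C : R) :
  (forall A : {fset I}, \sum_(i <- A) Normc.normc (f i) <= C) ->
  exists S : R[i]^o, summability.partial_sum (f : I -> R[i]^o) @ summability.totally --> S.
Proof.
move=> f_le; set N := fun i => Normc.normc (f i).
have N_ge0 i : 0 <= N i by rewrite -ler0c; exact: normr_ge0 (f i).
have part (h : I -> R) : (forall i, `|h i| <= N i) ->
    cvg (summability.partial_sum h @ summability.totally).
  move=> h_le.
  have -> : summability.partial_sum h =
      summability.partial_sum (fun i => h i + N i) - summability.partial_sum N.
    apply/funext => A; rewrite [RHS]/GRing.add /= [X in _ + X]/GRing.opp /= !partial_sumE.
    by rewrite big_split addrK.
  apply: is_cvgB; last exact: cvg_partial_sum_ge0 f_le.
  apply: (@cvg_partial_sum_ge0 _ (C + C)) => [i|A].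
    by have := h_le i; rewrite ler_norml; lra.
  rewrite big_split lerD // (le_trans _ (f_le A)) //.
  by apply: ler_sum => i _; apply: le_trans (h_le i); apply: ler_norm.
have /cvg_ex[a Re_a] :
    cvg (summability.partial_sum (fun i => complex.Re (f i)) @ summability.totally).
  apply: part => i; rewrite /N; case: (f i) => x y /=.
  by rewrite -sqrtr_sqr ler_wsqrtr // lerDl sqr_ge0.
have /cvg_ex[b Im_b] :
    cvg (summability.partial_sum (fun i => complex.Im (f i)) @ summability.totally).
  apply: part => i; rewrite /N; case: (f i) => x y /=.
  by rewrite -sqrtr_sqr ler_wsqrtr // lerDr sqr_ge0.
exists (Complex a b).
have -> : summability.partial_sum (f : I -> R[i]^o) =
    fun A => Complex (summability.partial_sum (fun i => complex.Re (f i)) A)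
                     (summability.partial_sum (fun i => complex.Im (f i)) A).
  apply/funext => A; rewrite !partial_sumE -Re_sum -Im_sum.
  by case: (\sum_(i <- A) _).
exact: cvg_Complex.
Qed.
End UnorderedSums.

(** * Limits, finite series and the ratio test *)

Section Convergence.
Variable R : realType.

Lemma cvg_exprC (x : R[i]) : `|x| < 1 -> (x ^+ n : R[i]^o) @[n --> \oo] --> (0 : R[i]^o).
Proof.
move=> x_lt1; apply/cvgrPdist_lt => -[e e']; rewrite ltcE /= => /andP[/eqP -> e_gt0].
have X_lt1 : `|Normc.normc x| < 1.
  rewrite ger0_norm; first by rewrite -ltcR; exact: x_lt1.
  by rewrite -ler0c; exact: normr_ge0 x.
have /cvgrPdist_lt/(_ e e_gt0) := cvg_expr X_lt1.
apply: filterS => n; rewrite !sub0r !normrN => lt_e.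
rewrite normrX -[ `|x| ]/(real_complex R (Normc.normc x)) -rmorphXn.
rewrite -[Complex e 0]/(real_complex R e) ltcR.
by apply: le_lt_trans lt_e; apply: ler_norm.
Qed.

Lemma cvg_geometric_sum (x : R[i]) : `|x| < 1 ->
  (\sum_(0 <= d < n) x ^+ d : R[i]^o) @[n --> \oo] --> ((1 - x)^-1 : R[i]^o).
Proof.
move=> x_lt1; have x_neq1 : 1 - x != 0 by have := one_sub_expr_neq0 x_lt1 0; rewrite expr1.
have -> : (1 - x)^-1 = (1 - x)^-1 * (1 - 0) by rewrite subr0 mulr1.
have -> : (fun n => \sum_(0 <= d < n) x ^+ d : R[i]^o) = fun n => (1 - x)^-1 * (1 - x ^+ n).
  apply/funext => n; apply: (mulfI x_neq1); rewrite mulVKf //.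
  by rewrite big_mkord -[in RHS](expr1n _ n) subrXX; congr (_ * _);
     apply: eq_bigr => i _; rewrite expr1n mul1r.
apply: cvgM; first exact: cvg_cst.
by apply: cvgB; [exact: cvg_cst|exact: cvg_exprC].
Qed.

Lemma cvg_prod_ord (m : nat) (u : nat -> nat -> R[i]) (l : nat -> R[i]) :
  (forall i, (u i n : R[i]^o) @[n --> \oo] --> (l i : R[i]^o)) ->
  (\prod_(i < m) u i n : R[i]^o) @[n --> \oo] --> (\prod_(i < m) l i : R[i]^o).
Proof.
move=> ul; elim: m => [|m IH].
  by under eq_fun do rewrite big_ord0; rewrite big_ord0; exact: cvg_cst.
under eq_fun do rewrite big_ord_recr /=; rewrite big_ord_recr /=.
by apply: cvgM; [exact: IH|exact: ul].
Qed.

Lemma cvg_sum_ord (m : nat) (u : nat -> nat -> R[i]) (l : nat -> R[i]) :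
  (forall i, (u i n : R[i]^o) @[n --> \oo] --> (l i : R[i]^o)) ->
  (\sum_(i < m) u i n : R[i]^o) @[n --> \oo] --> (\sum_(i < m) l i : R[i]^o).
Proof.
move=> ul; elim: m => [|m IH].
  by under eq_fun do rewrite big_ord0; rewrite big_ord0; exact: cvg_cst.
under eq_fun do rewrite big_ord_recr /=; rewrite big_ord_recr /=.
by apply: cvgD; [exact: IH|exact: ul].
Qed.

Lemma csum_finite (m n : nat) (u : nat -> R[i]) : (forall i, (n <= i)%N -> u i = 0) ->
  csum m u = \sum_(m <= i < n) u i.
Proof.
move=> u0; rewrite /csum; apply: (@lim_near_cst R[i]^o); first exact: norm_hausdorff.
exists n => // k /= le_nk.
case: (leqP m n) => [le_mn|lt_nm].
  have tail0 : \sum_(n <= i < k) u i = 0.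
    by rewrite big_nat_cond big1 // => i /andP[/andP[/u0]].
  by rewrite (big_cat_nat le_mn le_nk) /= tail0 addr0.
rewrite [RHS]big_geq ?(ltnW lt_nm) // big_nat_cond big1 // => i /andP[/andP[le_mi _] _].
by apply: u0; rewrite (leq_trans (ltnW lt_nm)).
Qed.

(** Past some index N the ratios are at most the midpoint c of l and 1; from there on, the partial
    sum of the products plus the next product divided by 1 - c no longer increases. *)
Lemma bounded_ratio_products (rho : nat -> R) (l : R) : (forall i, 0 <= rho i) ->
  rho @ \oo --> l -> l < 1 ->
  exists C, forall M, \sum_(0 <= m < M) \prod_(i < m) rho i <= C.
Proof.
move=> rho_ge0 rho_l l_lt1; pose c := (l + 1) / 2.
have c_lt1 : c < 1 by rewrite /c; lra.
have [N _ le_c] : \forall i \near \oo, rho i <= c by apply: cvgr_le rho_l _ _; rewrite /c; lra.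
pose U m := \prod_(i < m) rho i.
have U_ge0 m : 0 <= U m by apply: prodr_ge0.
have tail k : \sum_(0 <= m < N + k) U m + U (N + k)%N / (1 - c) <=
    \sum_(0 <= m < N) U m + U N / (1 - c).
  elim: k => [|k IH]; first by rewrite addn0.
  apply: le_trans IH; rewrite addnS big_nat_recr //= -addrA lerD2l.
  have step : U (N + k).+1 <= c * U (N + k)%N.
    rewrite {1}/U big_ord_recr /= mulrC; apply: ler_wpM2r; first exact: U_ge0.
    exact: le_c (leq_addr _ _).
  have -> : U (N + k)%N / (1 - c) = U (N + k)%N + c * U (N + k)%N / (1 - c).
    by field; rewrite subr_eq0 eq_sym lt_eqF.
  by rewrite lerD2l ler_pM2r // invr_gt0 subr_gt0.
exists (\sum_(0 <= m < N) U m + U N / (1 - c)) => M.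
apply: le_trans (tail M).
rewrite (@big_cat_nat _ _ _ M 0 (N + M)) ?leq_addl //= -addrA lerDl addr_ge0 ?sumr_ge0 //.
by rewrite divr_ge0 // subr_ge0 ltW.
Qed.
End Convergence.

(** * Summation over finite boxes of increments *)

Definition steps (N : nat) : seq (nat * bool) :=
  [seq (d, x) | d <- index_iota 0 N, x <- [:: false; true]].

Fixpoint box (N m : nat) : seq (seq (nat * bool)) :=
  if m is m'.+1 then [seq p :: e | p <- steps N, e <- box N m'] else [:: [::]].

(** This truncation bounds the length and each increment separately, instead of the weight, so that
    sums over a fixed length factor into geometric sums. *)
Fixpoint codes (N M : nat) : seq (seq (nat * bool)) :=
  if M is M'.+1 then codes N M' ++ box N M' else [::].

Lemma mem_steps N p : (p \in steps N) = (p.1 < N)%N.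
Proof.
apply/allpairsP/idP => [[[d x] [/= + _ ->]]|]; first by rewrite mem_index_iota.
case: p => d x /= lt_d; exists (d, x); split=> //=; first by rewrite mem_index_iota.
by case: x.
Qed.

Lemma uniq_steps N : uniq (steps N).
Proof. by apply: allpairs_uniq => [||[? ?] [? ?]]; first exact: iota_uniq. Qed.

Lemma mem_box N m e : (e \in box N m) = (size e == m) && all (fun p => p.1 < N)%N e.
Proof.
elim: m e => [|m IH] [|p e] //=; first by apply/allpairsP => -[[? ?] []].
rewrite eqSS andbCA -IH -mem_steps.
apply/allpairsP/andP => [[[p' e'] [/= ? ? [-> ->]]]|[p_in e_in]] //.
by exists (p, e).
Qed.

Lemma uniq_box N m : uniq (box N m).
Proof.
elim: m => //= m IH; apply: allpairs_uniq; rewrite ?uniq_steps // => -[? ?] [? ?] _ _ /=.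
by case=> -> ->.
Qed.

Lemma mem_codes N M e : (e \in codes N M) = (size e < M)%N && all (fun p => p.1 < N)%N e.
Proof.
elim: M => [|M IH]; first by [].
rewrite mem_cat IH mem_box -andb_orl; congr (_ && _).
by rewrite ltnS [in RHS]leq_eqVlt orbC.
Qed.

Lemma uniq_codes N M : uniq (codes N M).
Proof.
elim: M => //= M IH; rewrite cat_uniq IH uniq_box andbT /=.
by apply/hasPn => e; rewrite mem_box /= mem_codes => /andP[/eqP -> _]; rewrite ltnn.
Qed.

Section CodeSums.
Variables (K : comNzRingType) (g : seq bool -> nat) (z q : K).

(** Increments and overlines vary independently, and each position yields a geometric sum. A general
    G lets the induction absorb the first letter. *)
Lemma box_sum (G : seq bool -> K) k N m :
  \sum_(e <- box N m) G (overlines e) * q ^+ incr_weight k e =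
  (\prod_(i < m) \sum_(0 <= d < N) (q ^+ (k + i)) ^+ d) * \sum_(b <- bits m) G b.
Proof.
elim: m k G => [|m IH] k G.
  by rewrite !big_cons !big_nil big_ord0 mul1r expr0 mulr1.
rewrite big_allpairs_dep /steps big_allpairs_dep /= big_ord_recl addn0 -mulrA mulr_suml.
apply: eq_bigr => d _; rewrite !big_cons big_nil addr0 big_bitsS.
have step x : \sum_(e <- box N m) G (overlines ((d, x) :: e)) * q ^+ incr_weight k ((d, x) :: e) =
    (q ^+ k) ^+ d * ((\prod_(i < m) \sum_(0 <= d < N) (q ^+ (k + i.+1)) ^+ d) *
      \sum_(b <- bits m) G (x :: b)).
  under [in RHS]eq_bigr do under eq_bigr do rewrite addnS -addSn.
  rewrite -(IH k.+1 (fun b => G (x :: b))) mulr_sumr; apply: eq_bigr => e _ /=.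
  by rewrite exprD exprM mulrCA.
by rewrite !step -!mulrDr.
Qed.

Definition code_term (e : seq (nat * bool)) : K :=
  z ^+ count id (overlines e) *
  q ^+ (size e + incr_weight 1 e + gap_weight g 1 (overlines e)).

Definition bits_gf (good : pred (seq bool)) (m : nat) : K :=
  \sum_(b <- bits m | good b) z ^+ count id b * q ^+ gap_weight g 1 b.

Lemma codes_sum (good : pred (seq bool)) N M :
  \sum_(e <- codes N M | good (overlines e)) code_term e =
  \sum_(m < M) q ^+ m * (\prod_(i < m) \sum_(0 <= d < N) (q ^+ i.+1) ^+ d) * bits_gf good m.
Proof.
elim: M => [|M IH]; first by rewrite big_nil big_ord0.
rewrite big_cat IH big_ord_recr; congr (_ + _).
pose G b := if good b then z ^+ count id b * q ^+ gap_weight g 1 b else 0.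
rewrite /bits_gf big_mkcond [X in _ * X]big_mkcond -mulrA -(box_sum G 1) mulr_sumr.
rewrite big_seq [RHS]big_seq; apply: eq_bigr => e; rewrite mem_box => /andP[/eqP <- _].
rewrite /G /code_term; case: ifP => _; last by rewrite mul0r mulr0.
by rewrite !exprD; ring.
Qed.
End CodeSums.

(** * Generating functions of gapped overpartitions *)

Section GappedGeneratingFunction.
Variables (R : realType) (g : seq bool -> nat) (good : pred (seq bool)).

Definition good_gapped (pi : seq part) : bool := gapped g pi && good (overlines pi).

Definition parts (N M : nat) : seq (seq part) :=
  [seq decode_gaps g e | e <- codes N M & good (overlines e)].

Lemma good_gapped_parts N M : all good_gapped (parts N M).
Proof.
apply/allP => pi /mapP[e + ->]; rewrite mem_filter => /andP[good_e _].
by rewrite /good_gapped gapped_decode overlines_decode.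
Qed.

Lemma uniq_parts N M : uniq (parts N M).
Proof.
by rewrite map_inj_uniq; [exact: filter_uniq (uniq_codes _ _)|exact: can_inj (decode_gapsK g)].
Qed.

Lemma sub_parts (A : seq (seq part)) : all good_gapped A ->
  exists N0, forall N M, (N0 <= N)%N -> (N0 <= M)%N -> {subset A <= parts N M}.
Proof.
elim: A => [|pi A IH] /=; first by exists 0%N.
case/andP => /andP[pi_g pi_good] /IH[N0 A_sub].
pose e := encode_gaps g pi; have decode_e : decode_gaps g e = pi := encode_gapsK pi_g.
(* Length plus total increment bounds both the length and each single increment. *)
exists (maxn N0 (size e + sumn (unzip1 e)).+1) => N M.
rewrite !geq_max => /andP[leN ltN] /andP[leM ltM] pi'.
rewrite inE => /predU1P[->|]; last exact: A_sub.
rewrite -decode_e; apply: map_f.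
rewrite mem_filter -(overlines_decode g e) decode_e pi_good mem_codes.
rewrite (leq_trans _ ltM) ?ltnS ?leq_addr //=.
apply/allP => p p_in; apply: leq_trans ltN; rewrite ltnS.
apply: leq_trans (leq_addl _ _).
elim: e {decode_e ltM} p_in => //= p' e IHe; rewrite inE => /predU1P[->|/IHe le_p].
  exact: leq_addr.
exact: leq_trans le_p (leq_addl _ _).
Qed.

(** The ring is general because the identity serves twice: with the norms of z and q for the
    absolute bound, and with z and q themselves for the series. *)
Lemma sum_parts (K : comNzRingType) (z q : K) N M :
  \sum_(pi <- parts N M) z ^+ num_overlined pi * q ^+ weight pi =
  \sum_(m < M) q ^+ m * (\prod_(i < m) \sum_(0 <= d < N) (q ^+ i.+1) ^+ d) *
     bits_gf g z q good m.
Proof.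
rewrite -codes_sum /parts big_map big_filter; apply: eq_bigr => e _.
by rewrite /num_overlined overlines_decode weight_decode.
Qed.

Definition parts_fset N M : {fset {p : seq part | good_gapped p}} :=
  seq_fset tt (pmap insub (parts N M)).

Lemma mem_parts_fset N M pi : (pi \in parts_fset N M) = (val pi \in parts N M).
Proof. by rewrite seq_fsetE mem_pmap_sub. Qed.

Lemma partial_sum_parts (V : zmodType) (h : seq part -> V) N M :
  summability.partial_sum (fun pi : {p : seq part | good_gapped p} => h (val pi)) (parts_fset N M) =
  \sum_(pi <- parts N M) h pi.
Proof.
rewrite partial_sumE (perm_big _ (seq_fset_perm _ _)) undup_id; last first.
  exact: pmap_sub_uniq (uniq_parts N M).
rewrite -(big_map val xpredT h) (pmap_filter (insubK _)) (eq_filter (isSome_insub _)).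
by rewrite (all_filterP (good_gapped_parts N M)).
Qed.

Hypothesis sum_bits : forall (Z Q : R) (m : nat),
  \sum_(b <- bits m) Z ^+ count id b * Q ^+ gap_weight g 1 b = \prod_(i < m) (1 + Z * Q ^+ i).

(** Dropping [good] and completing the geometric sums only increases the terms. By [sum_bits] the
    m-th bound is the product of the rho i for i < m, and rho tends to Q < 1. *)
Lemma sum_parts_bounded (Z Q : R) : 0 <= Z -> 0 <= Q -> Q < 1 ->
  exists C, forall N M, \sum_(pi <- parts N M) Z ^+ num_overlined pi * Q ^+ weight pi <= C.
Proof.
move=> Z_ge0 Q_ge0 Q_lt1.
have QS_lt1 i : Q ^+ i.+1 < 1 by rewrite exprn_ilt1.
pose rho i := Q * ((1 - Q ^+ i.+1)^-1 * (1 + Z * Q ^+ i)).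
have rho_ge0 i : 0 <= rho i.
  by rewrite !mulr_ge0 ?invr_ge0 ?subr_ge0 ?(ltW (QS_lt1 i)) ?addr_ge0 ?mulr_ge0 ?exprn_ge0.
have Qn_cvg : (Q ^+ n) @[n --> \oo] --> (0 : R) by apply: cvg_expr; rewrite ger0_norm.
have rho_cvg : rho @ \oo --> Q * ((1 - 0)^-1 * (1 + Z * 0)).
  apply: cvgM; first exact: cvg_cst.
  apply: cvgM.
    apply: cvgV; first by rewrite subr0 oner_neq0.
    by apply: cvgB; [exact: cvg_cst|rewrite (cvg_shiftS (fun n => Q ^+ n))].
  apply: cvgD; first exact: cvg_cst.
  by apply: cvgM; [exact: cvg_cst|exact: Qn_cvg].
rewrite subr0 invr1 mulr0 addr0 !mulr1 in rho_cvg.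
have [C le_C] := bounded_ratio_products rho_ge0 rho_cvg Q_lt1.
exists C => N M; rewrite sum_parts; apply: le_trans (le_C M); rewrite big_mkord.
apply: ler_sum => m _; rewrite /rho !big_split prodr_const card_ord -mulrA.
apply: ler_wpM2l; first exact: exprn_ge0.
apply: ler_pM.
- by apply: prodr_ge0 => i _; apply: sumr_ge0 => d _; rewrite !exprn_ge0.
- by apply: sumr_ge0 => b _; rewrite mulr_ge0 ?exprn_ge0.
- apply: ler_prod => i _; apply/andP; split; first by apply: sumr_ge0 => d _; rewrite !exprn_ge0.
  rewrite -[leRHS]mul1r ler_pdivlMr ?subr_gt0 // mulrC big_mkord.
  have -> : (1 - Q ^+ i.+1) * (\sum_(d < N) (Q ^+ i.+1) ^+ d) = 1 - (Q ^+ i.+1) ^+ N.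
    by rewrite -[in RHS](expr1n _ N) subrXX; congr (_ * _);
       apply: eq_bigr => d _; rewrite expr1n mul1r.
  by rewrite gerBl !exprn_ge0.
rewrite -sum_bits /bits_gf [leLHS]big_mkcond; apply: ler_sum => b _.
by case: ifP => // _; rewrite mulr_ge0 ?exprn_ge0.
Qed.

Variables (z q : R[i]).
Hypothesis hq : `|q| < 1.

Let h (pi : seq part) : R[i]^o := z ^+ num_overlined pi * q ^+ weight pi.

(** Any finite family lies in some [parts], so its sum of norms obeys the uniform bound. *)
Lemma has_gf_good_gapped : exists S, has_gf good_gapped z q S.
Proof.
have normc_ge0 (x : R[i]) : 0 <= Normc.normc x by rewrite -ler0c; exact: normr_ge0 x.
have Q_lt1 : Normc.normc q < 1 by rewrite -ltcR; exact: hq.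
have [C le_C] := sum_parts_bounded (normc_ge0 z) (normc_ge0 q) Q_lt1.
pose hN pi : R := Normc.normc z ^+ num_overlined pi * Normc.normc q ^+ weight pi.
have hNE pi : Normc.normc (h pi) = hN pi.
  apply: (@complexI R); rewrite rmorphM !rmorphXn /=.
  rewrite -[LHS]/(`|z ^+ num_overlined pi * q ^+ weight pi|).
  by rewrite normrM !normrX.
apply: (@cvg_partial_sum _ _ _ C) => A; under eq_bigr do rewrite hNE.
rewrite -(big_map val xpredT hN).
have all_A : all good_gapped (map val A) by apply/allP => _ /mapP[p _ ->]; exact: valP.
have [N0 sub_A] := sub_parts all_A.
apply: le_trans (le_C N0 N0); apply: ler_sum_subset; rewrite ?uniq_parts //.
- by rewrite map_inj_uniq ?fset_uniq //; exact: val_inj.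
- exact: sub_A.
- by move=> pi; rewrite mulr_ge0 ?exprn_ge0.
Qed.

(** Sums over [parts N M] link both limits: for fixed M they tend, as N grows, to a partial sum of
    the series, and they are close to S once they contain a suitable finite set. *)
Lemma cvg_bits_gf : good [::] ->
  exists2 S : R[i]^o, has_gf good_gapped z q S &
    (1 + \sum_(1 <= m < M) (q ^+ m / qpoch q q m * bits_gf g z q good m)) @[M --> \oo] --> S.
Proof.
move=> good0; have [S S_gf] := has_gf_good_gapped; exists S => //.
pose T m := q ^+ m / qpoch q q m * bits_gf g z q good m.
have T0 : T 0%N = 1.
  rewrite /T /qpoch big_ord0 expr0 divr1 mul1r /bits_gf big_cons big_nil good0 addr0.
  by rewrite mulr1.
have box_cvg M :
    (\sum_(pi <- parts N M) h pi : R[i]^o) @[N --> \oo] --> (\sum_(m < M) T m : R[i]^o).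
  under eq_fun do rewrite sum_parts.
  apply: (cvg_sum_ord (u := fun m N => q ^+ m *
    (\prod_(i < m) \sum_(0 <= d < N) (q ^+ i.+1) ^+ d) * bits_gf g z q good m)) => m.
  apply: cvgM; last exact: cvg_cst.
  apply: cvgM; first exact: cvg_cst.
  have -> : (qpoch q q m)^-1 = \prod_(i < m) (1 - q ^+ i.+1)^-1.
    by rewrite prodfV; congr (_^-1); apply: eq_bigr => i _; rewrite exprS.
  apply: (cvg_prod_ord (u := fun i N => \sum_(0 <= d < N) (q ^+ i.+1) ^+ d)
    (l := fun i => (1 - q ^+ i.+1)^-1)) => i.
  by apply: cvg_geometric_sum; rewrite normrX exprn_ilt1.
apply/(@cvgrPdist_lt _ R[i]^o) => e e_gt0; have e2 : 0 < e / 2 by rewrite divr_gt0.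
have /cvgrPdist_lt/(_ _ e2)[A0 _ near_S] := S_gf.
have all_A0 : all good_gapped (map val A0) by apply/allP => _ /mapP[p _ ->]; exact: valP.
have [N0 sub_A0] := sub_parts all_A0.
exists N0.+1 => // M /= lt_M.
have -> : 1 + \sum_(1 <= m < M) T m = \sum_(m < M) T m.
  by rewrite -T0 -(big_mkord xpredT T) [in RHS]big_ltn // (leq_trans _ lt_M).
have /cvgrPdist_lt/(_ _ e2)[N1 _ near_T] := box_cvg M.
(* N is chosen after M; closeness to S only asks that both be at least N0. *)
pose N := maxn N0 N1.
have lt_S : `|S - \sum_(pi <- parts N M) h pi| < e / 2.
  rewrite -partial_sum_parts; apply: near_S => /=; apply/fsubsetP => p p_A0.
  rewrite mem_parts_fset; apply: sub_A0; rewrite ?leq_maxl ?(ltnW lt_M) //.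
  exact: map_f.
have lt_T : `|\sum_(m < M) T m - \sum_(pi <- parts N M) h pi| < e / 2.
  by apply: near_T => /=; exact: leq_maxr.
rewrite (splitr e) -(subrKA (\sum_(pi <- parts N M) h pi)).
by apply: le_lt_trans (ler_normD _ _) _; rewrite ltrD // distrC.
Qed.

End GappedGeneratingFunction.

(** * The terms of the series *)

Section SumBits.
Variable K : comNzRingType.

(** Letters are independent: position k + i contributes Z Q^(k+i) for a one and 1 for a zero. *)
Lemma sum_bits_pos_sum (Z Q : K) k m :
  \sum_(b <- bits m) Z ^+ count id b * Q ^+ pos_sum k b = \prod_(i < m) (1 + Z * Q ^+ (k + i)).
Proof.
elim: m k => [|m IH] k; first by rewrite big_ord0 big_cons big_nil addr0 mulr1.
rewrite big_bitsS big_ord_recl /= addn0 mulrDl mul1r.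
have -> : \prod_(i < m) (1 + Z * Q ^+ (k + bump 0 i)) = \prod_(i < m) (1 + Z * Q ^+ (k.+1 + i)).
  by apply: eq_bigr => i _; rewrite /bump addnA addn1.
rewrite -IH; congr (_ + _); rewrite mulr_sumr; apply: eq_bigr => b _.
by rewrite add1n exprS mul1n exprD; ring.
Qed.

Lemma sum_bits_first (Z Q : K) m :
  \sum_(b <- bits m) Z ^+ count id b * Q ^+ gap_weight gap_first 1 b =
  \prod_(i < m) (1 + Z * Q ^+ i).
Proof. by under eq_bigr do rewrite gap_weight_first; rewrite sum_bits_pos_sum. Qed.

(** The free last letter contributes 1 + Z, as the first letter does in the other convention, and
    the other positions are counted from 1. *)
Lemma sum_bits_last (Z Q : K) m :
  \sum_(b <- bits m) Z ^+ count id b * Q ^+ gap_weight gap_last 1 b =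
  \prod_(i < m) (1 + Z * Q ^+ i).
Proof.
case: m => [|m]; first by rewrite big_ord0 big_cons big_nil addr0 mulr1.
rewrite big_bitsS_rcons big_ord_recl mulr1 mulrDl mul1r.
rewrite -(sum_bits_pos_sum _ _ 1 m) mulr_sumr; congr (_ + _); apply: eq_bigr => b _;
  rewrite gap_weight_last count_rcons ?addn0 ?addn1 //.
by rewrite exprS mulrA.
Qed.
End SumBits.

Section Terms.
Variables (R : realType) (z q : R[i]).
Hypothesis hq : `|q| < 1.

Lemma has_gf_terms g good (P : pred (seq part)) (t : nat -> R[i]) :
  (forall (Z Q : R) m, \sum_(b <- bits m) Z ^+ count id b * Q ^+ gap_weight g 1 b =
     \prod_(i < m) (1 + Z * Q ^+ i)) ->
  P =1 good_gapped g good -> good [::] ->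
  (forall m, t m.+1 = q ^+ m.+1 / qpoch q q m.+1 * bits_gf g z q good m.+1) ->
  exists2 S : R[i]^o, has_gf P z q S & (1 + \sum_(1 <= m < M) t m) @[M --> \oo] --> S.
Proof.
move=> sum_bits /funext -> good0 tE.
have [S S_gf S_cvg] := cvg_bits_gf sum_bits z hq good0; exists S => //.
rewrite (_ : (fun M => _) = fun M =>
  1 + \sum_(1 <= m < M) (q ^+ m / qpoch q q m * bits_gf g z q good m)) //.
by apply/funext => M; congr (1 + _); apply: eq_big_nat => -[|m] // _.
Qed.

Lemma bits_gf_count g good m : bits_gf g z q good m =
  \sum_(0 <= s < m.+1) z ^+ s *
    \sum_(b <- bits m | good b && (count id b == s)) q ^+ gap_weight g 1 b.
Proof.
rewrite /bits_gf big_bits_count; apply: eq_bigr => s _; rewrite mulr_sumr.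
by apply: eq_bigr => b /andP[_ /eqP ->].
Qed.

Lemma sqr_sub_bin2 (i : nat) : i%:Z ^+ 2 - i%:Z = 'C(i, 2)%:Z * 2.
Proof. elim: i => [|i IH] //; rewrite binS bin1 PoszD mulrDl -IH intS; ring. Qed.

Lemma half_sqr_sub (i : nat) : ((i%:Z ^+ 2 - i%:Z) %/ 2)%Z = 'C(i, 2).
Proof. by rewrite sqr_sub_bin2 mulzK. Qed.

Lemma half_mul_sqr_sub (r i : nat) :
  ((r%:Z * (i%:Z ^+ 2 - i%:Z)) %/ 2)%Z = (r * 'C(i, 2))%N.
Proof. by rewrite sqr_sub_bin2 mulrA mulzK. Qed.

Lemma term_Fbar m :
  \sum_(0 <= s <oo) (z ^+ s * q ^ (m.+1%:Z + s%:Z ^+ 2 - s%:Z) / qpoch q q m.+1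
     * qbinom q 1 (m.+1%:Z - s%:Z + 1) s%:Z) =
  q ^+ m.+1 / qpoch q q m.+1 * bits_gf gap_first z q no_tt m.+1.
Proof.
rewrite (@csum_finite _ _ m.+2) => [|s lt_s]; last by rewrite qbinom_lt ?mulr0 //; lia.
rewrite bits_gf_count mulr_sumr; apply: eq_bigr => s _.
under eq_bigr do rewrite gap_weight_first.
rewrite -/(bit_sum _ _ _ _ _) bit_sum_no_tt //.
have -> : m.+1%:Z + s%:Z ^+ 2 - s%:Z = (m.+1 + (s * s - s))%N by rewrite expr2; nia.
by rewrite -exprnP exprD; ring.
Qed.

Lemma term_Lbar m :
  \sum_(0 <= s <oo) (z ^+ s * q ^ (m.+1%:Z + (s%:Z - 1) ^+ 2) / qpoch q q m.+1
     * (qbinom q 1 (m.+1%:Z - s%:Z) (s%:Z - 1)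
        + q ^ (2 * s%:Z - 1) * qbinom q 1 (m.+1%:Z - s%:Z) s%:Z)) =
  q ^+ m.+1 / qpoch q q m.+1 * bits_gf gap_last z q no_tt m.+1.
Proof.
rewrite (@csum_finite _ _ m.+2) => [|s lt_s]; last first.
  by rewrite !qbinom_lt ?mulr0 ?addr0 ?mulr0 //; lia.
rewrite bits_gf_count mulr_sumr; apply: eq_bigr => s _.
rewrite last_bit_sum_no_tt //; case: s => [|s].
  (* At s = 0 the first binomial vanishes, its lower index being negative, and the factor q^-1
     lowers q^(m+2) to q^(m+1). *)
  have -> : qbinom q 1 (m.+1%:Z - 0%N%:Z) (0%N%:Z - 1) = 0 by [].
  have -> : m.+1%:Z + (0%N%:Z - 1) ^+ 2 = m.+2%:Z by lia.
  have -> : q ^ (2 * 0%N%:Z - 1) = q^-1 by [].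
  rewrite !add0r mul0n !expr0 !mul1r -exprnP.
  (* For q = 0 both sides vanish through their positive powers of q. *)
  case: (eqVneq q 0) => [->|q_neq0]; first by rewrite !expr0n /= !mul0r.
  by rewrite exprS; field; rewrite q_neq0 (@qpoch_neq0 _ _ hq 1).
have -> : m.+1%:Z + (s.+1%:Z - 1) ^+ 2 = (m.+1 + s * s)%N by rewrite expr2; nia.
have -> : 2 * s.+1%:Z - 1 = (2 * s).+1 by lia.
have -> : m.+1%:Z - s.+1%:Z = m%:Z - s%:Z by lia.
have -> : s.+1%:Z - 1 = s by lia.
have -> : (s.+1 * s.+1 = s * s + (2 * s).+1)%N by nia.
by rewrite -!exprnP !exprD; ring.
Qed.

Section Run.
Variable r : nat.
Hypothesis r_gt0 : (0 < r)%N.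

Lemma csum_run_sum s (n : int) :
  \sum_(0 <= i <oo) ((-1) ^+ i * q ^ ((r%:Z * (i%:Z ^+ 2 - i%:Z)) %/ 2)%Z
     * qbinom q r s.+1 i%:Z * qbinom q 1 (n - r%:Z * i%:Z) s%:Z) = run_sum q r s n.
Proof.
rewrite (@csum_finite _ _ s.+2) => [|i lt_i]; last first.
  by rewrite [qbinom q r _ _]qbinom_lt ?mulr0 ?mul0r //; lia.
by apply: eq_bigr => i _; rewrite half_mul_sqr_sub -exprnP.
Qed.

Lemma term_Fr m :
  \sum_(0 <= s <oo)
    (z ^+ s * q ^ (m.+1%:Z + ((s%:Z ^+ 2 - s%:Z) %/ 2)%Z) / qpoch q q m.+1
       * \sum_(0 <= i <oo)
           ((-1) ^+ i * q ^ ((r%:Z * (i%:Z ^+ 2 - i%:Z)) %/ 2)%Z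
              * qbinom q r (s%:Z + 1) i%:Z
              * qbinom q 1 (m.+1%:Z - r%:Z * i%:Z) s%:Z)) =
  q ^+ m.+1 / qpoch q q m.+1 * bits_gf gap_first z q (no_run r) m.+1.
Proof.
pose t s := z ^+ s * q ^+ (m.+1 + 'C(s, 2)) / qpoch q q m.+1 * run_sum q r s m.+1.
have -> : (fun s : nat => z ^+ s * q ^ (m.+1%:Z + ((s%:Z ^+ 2 - s%:Z) %/ 2)%Z) / qpoch q q m.+1
       * \sum_(0 <= i <oo)
           ((-1) ^+ i * q ^ ((r%:Z * (i%:Z ^+ 2 - i%:Z)) %/ 2)%Z
              * qbinom q r (s%:Z + 1) i%:Z
              * qbinom q 1 (m.+1%:Z - r%:Z * i%:Z) s%:Z)) = t.
  apply/funext => s; have -> : s%:Z + 1 = s.+1 by lia.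
  by rewrite csum_run_sum half_sqr_sub -PoszD -exprnP.
rewrite (@csum_finite _ _ m.+2) => [|s lt_s]; last by rewrite /t run_sum_lt ?mulr0 //; lia.
rewrite bits_gf_count mulr_sumr; apply: eq_bigr => s _.
under eq_bigr do rewrite gap_weight_first.
by rewrite -/(bit_sum _ _ _ _ _) bit_sum_no_run // /t exprD; ring.
Qed.

Lemma eq_csum m (u v : nat -> R[i]) : (forall i, (m <= i)%N -> u i = v i) ->
  csum m u = csum m v.
Proof.
move=> uv; rewrite /csum (_ : (fun n => _) = fun n => \sum_(m <= i < n) v i) //.
by apply/funext => n; apply: eq_big_nat => i /andP[/uv].
Qed.

Lemma csum_run_sum_shift s (n : int) (j : nat) : q != 0 ->
  \sum_(0 <= i <oo) ((-1) ^+ i * q ^ (((r%:Z * (i%:Z ^+ 2 - i%:Z)) %/ 2)%Z - j%:Z)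
     * qbinom q r s.+1 i%:Z * qbinom q 1 (n - r%:Z * i%:Z) s%:Z) = q ^- j * run_sum q r s n.
Proof.
move=> q_neq0; rewrite (@csum_finite _ _ s.+2) => [|i lt_i]; last first.
  by rewrite [qbinom q r _ _]qbinom_lt ?mulr0 ?mul0r //; lia.
rewrite /run_sum mulr_sumr; apply: eq_bigr => i _.
by rewrite half_mul_sqr_sub expfzDr // -exprnP -exprnN; ring.
Qed.

(** Only the all-zero word counts, and it is admissible exactly when m + 1 < r; the binomial with
    lower index 0 encodes this indicator. *)
Lemma last_bits_no_run0 m :
  \sum_(b <- bits m.+1 | no_run r b && (count id b == 0%N)) q ^+ gap_weight gap_last 1 b =
  qbinom q 1 (r%:Z - m.+1%:Z - 1) 0.
Proof.
have gap0 : gap_weight gap_last 1 (nseq m.+1 false) = 0%N.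
  by rewrite -[m.+1]addn1 nseqD cats1 gap_weight_last pos_sum_nseq.
rewrite big_bits_count0 gap0.
rewrite /no_run infix_false_nseq -ltnNge; case: ltnP => le_rm; last by rewrite qbinom_lt //; lia.
by rewrite -[0]/(0%N%:Z) qbinom0 //; lia.
Qed.

Lemma term_Lr m :
  (qpoch q q m.+1)^-1
    * (q ^ m.+1%:Z * qbinom q 1 (r%:Z - m.+1%:Z - 1) 0
       + \sum_(1 <= s <oo)
           (z ^+ s * q ^ (m.+1%:Z + ((s%:Z ^+ 2 - s%:Z) %/ 2)%Z)
              * (\sum_(0 <= i <oo)
                   ((-1) ^+ i * q ^ ((r%:Z * (i%:Z ^+ 2 - i%:Z)) %/ 2)%Z
                      * qbinom q r s%:Z i%:Z
                      * qbinom q 1 (m.+1%:Z - r%:Z * i%:Z - 1) (s%:Z - 1))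
                 + q ^ m.+1%:Z
                   * \sum_(1 <= j < r) \sum_(0 <= i <oo)
                       ((-1) ^+ i
                          * q ^ (((r%:Z * (i%:Z ^+ 2 - i%:Z)) %/ 2)%Z - j%:Z)
                          * qbinom q r s%:Z i%:Z
                          * qbinom q 1 (m.+1%:Z - j%:Z - r%:Z * i%:Z - 1)
                              (s%:Z - 1))))) =
  q ^+ m.+1 / qpoch q q m.+1 * bits_gf gap_last z q (no_run r) m.+1.
Proof.
have [q0|q_neq0] := eqVneq q 0.
  (* At q = 0 the outer positive powers of q annihilate both sides, whatever value the negative
     powers take. *)
  rewrite (@csum_finite _ _ 1) => [|s _].
    by rewrite big_geq // -exprnP q0 !expr0n /= !mul0r addr0 mulr0.
  by rewrite half_sqr_sub -PoszD -exprnP q0 expr0n mulr0 mul0r.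
pose t s := z ^+ s *
  \sum_(b <- bits m.+1 | no_run r b && (count id b == s)) q ^+ gap_weight gap_last 1 b.
rewrite [csum 1 _](_ : _ = csum 1 (fun s => q ^+ m.+1 * t s)); last first.
  apply: eq_csum => -[//|s] _; rewrite half_sqr_sub -PoszD -!exprnP.
  rewrite [X in _ * (X + _)](_ : _ = run_sum q r s m); last first.
    by rewrite -csum_run_sum; apply: eq_csum => i _; congr (_ * qbinom _ _ _ _); lia.
  rewrite [X in _ * (_ + _ * X)](_ : _ =
      \sum_(1 <= j < r) q ^- j * run_sum q r s (m%:Z - j%:Z)); last first.
    apply: eq_bigr => j _; rewrite -csum_run_sum_shift //.
    by apply: eq_csum => i _; congr (_ * qbinom _ _ _ _); lia.
  (* The terms with j > m vanish, and on the others q^(m+1) q^-j is a natural power. *)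
  rewrite [X in _ * (_ + X)](_ : _ =
      \sum_(1 <= j < r | (j <= m)%N) q ^+ (m.+1 - j) * run_sum q r s (m%:Z - j%:Z)); last first.
    rewrite mulr_sumr [RHS]big_mkcond; apply: eq_bigr => j _; case: leqP => [le_jm|lt_mj].
      by rewrite mulrA -expfB.
    by rewrite run_sum_lt ?mulr0 //; lia.
  by rewrite /t last_bit_sum_no_run // exprD; ring.
rewrite (@csum_finite _ _ m.+2) => [|s lt_s]; last by rewrite /t big_bits_count_gt ?mulr0.
rewrite bits_gf_count [in RHS]big_ltn // last_bits_no_run0 expr0 mul1r -mulr_sumr -exprnP.
by rewrite -mulrDr mulrA; congr (_ * _); rewrite mulrC.
Qed.
End Run.
End Terms.

Theorem theorem1p7 (R : realType) (z q : R[i]) (hq : `|q| < 1) :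
  [/\ exists2 S : R[i]^o,
        has_gf Fbar z q S
      & (1 + \sum_(1 <= m < M) \sum_(0 <= s <oo)
           (z ^+ s * q ^ (m%:Z + s%:Z ^+ 2 - s%:Z) / qpoch q q m
              * qbinom q 1 (m%:Z - s%:Z + 1) s%:Z))
          @[M --> \oo] --> S,
      exists2 S : R[i]^o,
        has_gf Lbar z q S
      & (1 + \sum_(1 <= m < M) \sum_(0 <= s <oo)
           (z ^+ s * q ^ (m%:Z + (s%:Z - 1) ^+ 2) / qpoch q q m
              * (qbinom q 1 (m%:Z - s%:Z) (s%:Z - 1)
                 + q ^ (2 * s%:Z - 1) * qbinom q 1 (m%:Z - s%:Z) s%:Z)))
          @[M --> \oo] --> S,
      forall r : nat, (1 <= r)%N ->
      exists2 S : R[i]^o,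
        has_gf (Fr r) z q S
      & (1 + \sum_(1 <= m < M) \sum_(0 <= s <oo)
           (z ^+ s * q ^ (m%:Z + ((s%:Z ^+ 2 - s%:Z) %/ 2)%Z) / qpoch q q m
              * \sum_(0 <= i <oo)
                  ((-1) ^+ i * q ^ ((r%:Z * (i%:Z ^+ 2 - i%:Z)) %/ 2)%Z
                     * qbinom q r (s%:Z + 1) i%:Z
                     * qbinom q 1 (m%:Z - r%:Z * i%:Z) s%:Z)))
          @[M --> \oo] --> S
    & forall r : nat, (1 <= r)%N ->
      exists2 S : R[i]^o,
        has_gf (Lr r) z q S
      & (1 + \sum_(1 <= m < M)
           ((qpoch q q m)^-1
              * (q ^ m%:Z * qbinom q 1 (r%:Z - m%:Z - 1) 0
                 + \sum_(1 <= s <oo)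
                     (z ^+ s * q ^ (m%:Z + ((s%:Z ^+ 2 - s%:Z) %/ 2)%Z)
                        * (\sum_(0 <= i <oo)
                             ((-1) ^+ i * q ^ ((r%:Z * (i%:Z ^+ 2 - i%:Z)) %/ 2)%Z
                                * qbinom q r s%:Z i%:Z
                                * qbinom q 1 (m%:Z - r%:Z * i%:Z - 1) (s%:Z - 1))
                           + q ^ m%:Z
                             * \sum_(1 <= j < r) \sum_(0 <= i <oo)
                                 ((-1) ^+ i
                                    * q ^ (((r%:Z * (i%:Z ^+ 2 - i%:Z)) %/ 2)%Z - j%:Z)
                                    * qbinom q r s%:Z i%:Z
                                    * qbinom q 1 (m%:Z - j%:Z - r%:Z * i%:Z - 1)
                                        (s%:Z - 1)))))))
          @[M --> \oo] --> S].
Proof.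
split=> [||r r_gt0|r r_gt0].
- apply: (@has_gf_terms _ z q hq gap_first no_tt) => //.
  + by move=> Z Q m; exact: sum_bits_first.
  + by move=> pi; rewrite /Fbar overpartition_firstE.
  + by move=> m; exact: term_Fbar.
- apply: (@has_gf_terms _ z q hq gap_last no_tt) => //.
  + by move=> Z Q m; exact: sum_bits_last.
  + by move=> pi; rewrite /Lbar overpartition_lastE.
  + by move=> m; exact: term_Lbar.
- apply: (@has_gf_terms _ z q hq gap_first (no_run r)) => //.
  + by move=> Z Q m; exact: sum_bits_first.
  + by move=> pi; rewrite /Fr overpartition_firstE.
  + by rewrite /no_run infixs0; case: r r_gt0.
  + by move=> m; exact: term_Fr.
- apply: (@has_gf_terms _ z q hq gap_last (no_run r)) => //.
  + by move=> Z Q m; exact: sum_bits_last.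
  + by move=> pi; rewrite /Lr overpartition_lastE.
  + by rewrite /no_run infixs0; case: r r_gt0.
  + by move=> m; exact: term_Lr.
Qed.
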